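(* Let $\Lambda$ be a free abelian group of finite rank, $E=\Lambda\otimes_{\mathbb Z}\mathbb R$ with a norm $\|\cdot\|$, let $d>1$ be an integer, and let $T=T_{d,m,r}\colon\Lambda\to\Lambda$ be the generalized Collatz mapping associated with $(d,m,r)$. Assume that $T$ is of relatively prime type and that the set $S_r=\{r_\omega : \omega\in\Lambda/d\Lambda\}$ of shift vectors is acute. Let $D_T\subseteq E$ be the tame cone of $T$. Then every point $x\in\Lambda\cap D_T$ has a divergent $T$-trajectory. Moreover, the lower asymptotic density of the set $\mathrm{Div}(T)$ of points of $\Lambda$ having a divergent $T$-trajectory satisfies $$\underline{\delta}(\mathrm{Div}(T))\ \geq\ \frac{\mathrm{vol}(D_T\cap\beta(1))}{\mathrm{vol}(\beta(1))},$$ where $\beta(1)$ denotes the closed unit ball in $E$ with respect to $\|\cdot\|$.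
   Context: $\Lambda$ is regarded as a lattice in the real vector space $E=\Lambda\otimes_{\mathbb Z}\mathbb R$. Generalized Collatz mapping: for every coset $\omega\in\Lambda/d\Lambda$ one chooses an integer $m_\omega>0$ and a vector $r_\omega\in\Lambda$ with $m_\omega\omega+r_\omega\equiv 0 \bmod d\Lambda$ (i.e. $m_\omega x+r_\omega\in d\Lambda$ for all $x\in\omega$), and defines $T(x)=\frac1d(m_\omega x+r_\omega)$ for $x\in\omega$. $T$ is of relatively prime type if $\gcd(d,m_\omega)=1$ for all $\omega\in\Lambda/d\Lambda$. A point $x\in\Lambda$ has a divergent $T$-trajectory if the sequence $(T^k(x))_{k\in\mathbb N}$ is not eventually periodic. $S_r$ is acute if there is a non-trivial linear form $\Phi\colon E\to\mathbb R$ with $\Phi(w)>0$ for all non-zero $w\in S_r$ (all non-zero vectors of $S_r$ lie in some open linear half-space). $B_r^+$ is the closed convex cone generated by $S_r$, i.e. the intersection of all closed linear half-spaces of $E$ containing $S_r$, and $B_r^-=-B_r^+$. A non-trivial linear form $\Phi\colon E\to\mathbb R$ is separating for $T$ if for all $\omega\in\Lambda/d\Lambda$ and all $x\in\omega$ with $\Phi(x)\neq0$ one has $|m_\omega\Phi(x)|>|\Phi(r_\omega)|$. A hyperplane $H\subset E$ is separating if $H=\ker\Phi$ for some separating linear form $\Phi$. When $T$ is of relatively prime type there are only finitely many separating hyperplanes $H_1,\dots,H_k$ (possibly $k=0$). Let $C_1,\dots,C_N$ be the connected components of $E\setminus\bigcup_{j=1}^kH_j$ (open convex cones). The component $C_i$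 is wild if $C_i\cap B_r^+\neq\emptyset$. The wild cone of $T$ is $W_T=B_r^-\cup\bigcup_{C_i\text{ wild}}\overline{C_i}$, and the tame cone is its complement $D_T=E\setminus W_T$. $\beta(\rho)$ is the closed ball of radius $\rho$ around $0$ in $E$. For $Z\subseteq\Lambda$, the lower asymptotic density is $\underline\delta(Z)=\liminf_{n\to\infty}\frac{|Z\cap\beta(n)|}{|\Lambda\cap\beta(n)|}$. $\mathrm{vol}$ is any fixed Lebesgue measure on $E$. *)

(* Defs.v *)
From HB Require Import structures.
From mathcomp Require Import all_boot all_order all_algebra.
From mathcomp Require Import finmap.
From mathcomp Require Import all_classical all_reals all_analysis.
Set Implicit Arguments.
Unset Strict Implicit.
Unset Printing Implicit Defensive.
Import Order.TTheory GRing.Theory Num.Theory.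
Import numFieldNormedType.Exports.
Local Open Scope classical_set_scope.
Local Open Scope ring_scope.
Local Open Scope quotient_scope.

Definition free_of_finite_rank (L : zmodType) : Prop :=
  exists (n : nat) (e : 'I_n -> L),
    bijective (fun c : {ffun 'I_n -> int} => \sum_(i < n) e i *~ c i).

(* The universal property of the extension of scalars of L from the integers
   to R: it determines the pair (E, iota), as a real vector space under L, up
   to unique isomorphism, with iota corresponding to x |-> x (x) 1. *)
Definition is_real_extension (R : realType) (L : zmodType) (E : lmodType R)
    (iota : {additive L -> E}) : Prop :=
  forall (V : lmodType R) (f : {additive L -> V}),
    (exists g : {linear E -> V}, forall x, g (iota x) = f x) /\
    (forall g h : {linear E -> V},
       (forall x, g (iota x) = f x) -> (forall x, h (iota x) = f x) ->
       forall v, g v = h v).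

Definition congr_mod (L : zmodType) (d : nat) : rel L :=
  fun x y => `[< exists z, x - y = z *+ d >].

Lemma congr_mod_refl (L : zmodType) d : reflexive (@congr_mod L d).
Proof. by move=> x; apply/asboolP; exists 0; rewrite subrr mul0rn. Qed.

Lemma congr_mod_sym (L : zmodType) d : symmetric (@congr_mod L d).
Proof.
move=> x y; apply/idP/idP => /asboolP[z xyz]; apply/asboolP; exists (- z);
  by rewrite mulNrn -xyz opprB.
Qed.

Lemma congr_mod_trans (L : zmodType) d : transitive (@congr_mod L d).
Proof.
move=> y x z /asboolP[a xya] /asboolP[b yzb]; apply/asboolP; exists (a + b).
by rewrite mulrnDl -xya -yzb addrA subrK.
Qed.

Canonical congr_mod_equiv (L : zmodType) (d : nat) :=
  EquivRel (@congr_mod L d) (@congr_mod_refl L d) (@congr_mod_sym L d)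
    (@congr_mod_trans L d).

(* L / dL *)
Definition cosets (L : zmodType) (d : nat) : Type :=
  {eq_quot (@congr_mod L d)}.

Definition coset_of (L : zmodType) (d : nat) (x : L) : cosets L d :=
  \pi_({eq_quot (@congr_mod L d)}) x.

Definition collatz_data (L : zmodType) (d : nat)
    (m : cosets L d -> nat) (r : cosets L d -> L) : Prop :=
  (forall w, (0 < m w)%N) /\
  (forall w x, coset_of d x = w -> exists y, x *+ m w + r w = y *+ d).

(* T x = (m_w x + r_w) / d for x in the coset w; as L is torsion-free in the
   intended use, this determines T. *)
Definition collatz_mapping (L : zmodType) (d : nat)
    (m : cosets L d -> nat) (r : cosets L d -> L) (T : L -> L) : Prop :=
  forall w x, coset_of d x = w -> T x *+ d = x *+ m w + r w.

Definition relatively_prime_type (L : zmodType) (d : nat)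
    (m : cosets L d -> nat) : Prop :=
  forall w, gcdn d (m w) = 1%N.

Definition divergent (L : Type) (T : L -> L) (x : L) : Prop :=
  ~ exists N p : nat, (0 < p)%N /\
      forall k : nat, (N <= k)%N -> iter (k + p) T x = iter k T x.

Definition Div (L : Type) (T : L -> L) : set L := [set x | divergent T x].

Definition nontrivial_form (R : realType) (E : lmodType R)
    (Phi : {scalar E}) : Prop :=
  exists v, Phi v != 0.

Definition shift_vectors (R : realType) (L : zmodType) (E : lmodType R)
    (iota : {additive L -> E}) (d : nat) (r : cosets L d -> L) : set E :=
  [set iota (r w) | w in [set: cosets L d]].

Definition acute (R : realType) (E : lmodType R) (S : set E) : Prop :=
  exists Phi : {scalar E}, nontrivial_form Phi /\
    forall w, S w -> w != 0 -> 0 < Phi w.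

Definition closed_half_space (R : realType) (E : lmodType R) (H : set E) : Prop :=
  exists Phi : {scalar E}, nontrivial_form Phi /\ H = [set v | 0 <= Phi v].

Definition cone_plus (R : realType) (E : lmodType R) (S : set E) : set E :=
  \bigcap_(H in [set H | closed_half_space H /\ S `<=` H]) H.

Definition cone_minus (R : realType) (E : lmodType R) (S : set E) : set E :=
  [set - v | v in cone_plus S].

Definition separating_form (R : realType) (L : zmodType) (E : lmodType R)
    (iota : {additive L -> E}) (d : nat) (m : cosets L d -> nat)
    (r : cosets L d -> L) (Phi : {scalar E}) : Prop :=
  nontrivial_form Phi /\
  forall w x, coset_of d x = w -> Phi (iota x) != 0 ->
    `|(m w)%:R * Phi (iota x)| > `|Phi (iota (r w))|.

Definition separating_hyperplane (R : realType) (L : zmodType) (E : lmodType R)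
    (iota : {additive L -> E}) (d : nat) (m : cosets L d -> nat)
    (r : cosets L d -> L) (H : set E) : Prop :=
  exists Phi : {scalar E},
    separating_form iota m r Phi /\ H = [set v | Phi v = 0].

Definition hyperplane_complement (R : realType) (L : zmodType) (E : lmodType R)
    (iota : {additive L -> E}) (d : nat) (m : cosets L d -> nat)
    (r : cosets L d -> L) : set E :=
  ~` \bigcup_(H in separating_hyperplane iota m r) H.

Definition components (T : topologicalType) (A : set T) : set (set T) :=
  [set connected_component A x | x in A].

Definition wild_component (R : realType) (L : zmodType) (E : normedModType R)
    (iota : {additive L -> E}) (d : nat) (m : cosets L d -> nat)
    (r : cosets L d -> L) (C : set E) : Prop :=
  components (hyperplane_complement iota m r) C /\
  C `&` cone_plus (shift_vectors iota r) !=set0.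

Definition wild_cone (R : realType) (L : zmodType) (E : normedModType R)
    (iota : {additive L -> E}) (d : nat) (m : cosets L d -> nat)
    (r : cosets L d -> L) : set E :=
  cone_minus (shift_vectors iota r) `|`
  \bigcup_(C in wild_component iota m r) closure C.

Definition tame_cone (R : realType) (L : zmodType) (E : normedModType R)
    (iota : {additive L -> E}) (d : nat) (m : cosets L d -> nat)
    (r : cosets L d -> L) : set E :=
  ~` wild_cone iota m r.

Definition beta (R : realType) (E : normedModType R) (rho : R) : set E :=
  [set v | `|v| <= rho].
Arguments beta {R} E rho.

(* The sets counted are finite when iota is a real extension of a free group of
   finite rank; fset_set sends infinite sets to the empty set. *)
Definition lower_density (R : realType) (L : zmodType) (E : normedModType R)
    (iota : {additive L -> E}) (Z : set L) : \bar R :=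
  limn_einf (fun n : nat =>
    ((#|` fset_set (Z `&` iota @^-1` beta E n%:R)|%:R : R) /
     (#|` fset_set (iota @^-1` beta E n%:R)|%:R : R))%:E).

Definition borel (T : topologicalType) := g_sigma_algebraType (@open T).

(* A Lebesgue measure on a finite-dimensional real vector space, no basis
   being distinguished: a nonzero translation-invariant Borel measure that is
   finite on compact sets. It is unique up to a positive factor. *)
Definition lebesgue_measure_on (R : realType) (E : normedModType R)
    (vol : {measure set (borel E) -> \bar R}) : Prop :=
  [/\ forall (a : E) (A : set (borel E)), measurable A ->
        vol [set (a + v : E) | v in A] = vol A,
      forall K : set E, compact K -> (vol K < +oo)%E &
      vol [set: E] != 0%E].

(* Main.v *)
Require Import Defs.
From HB Require Import structures.
From mathcomp Require Import all_boot all_order all_algebra.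
From mathcomp Require Import finmap.
From mathcomp Require Import all_classical all_reals all_analysis.
From mathcomp Require Import ring lra zify.
Set Implicit Arguments.
Unset Strict Implicit.
Unset Printing Implicit Defensive.
Import Order.TTheory GRing.Theory Num.Theory.
Import numFieldNormedType.Exports.
Local Open Scope classical_set_scope.
Local Open Scope ring_scope.

(** Divergence. After [k] steps [d^k T^k(x) = M x + s], where [M] is a product of
    multipliers, hence prime to [d], and [s] is a nonnegative combination of the
    shift vectors ([form_iter]). A point of period [p] thus satisfies
    [(d^p - M) y = s] with [d^p <> M], so it lies in the cone of the shifts or in
    the opposite cone ([periodic_in_cone]). A point whose trajectory enters the
    opposite cone was there from the start. Along a trajectory the nonzero value
    of a separating form keeps its sign ([separating_sign]), so a point whose
    trajectory enters the cone lies in the closure of a wild component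
    ([tame_divergent]). Points on separating hyperplanes require care: one
    perturbs the periodic point inside the cone, which is possible because the
    shifts span the space, the multipliers being invertible modulo [d]
    ([shifts_span]), and because there are finitely many separating hyperplanes:
    up to scaling, a separating form takes bounded integral values on the shifts
    of the basis vectors ([separating_forms_finite]).

    Density. Finiteness also makes the tame cone open, and it is invariant
    under positive dilations. For an open cone the proportion of lattice points
    in large balls is at least the proportion of volume ([density_open_cone]).
    Instead of growing the ball one shrinks the lattice: the lattice of mesh [h]
    cuts the space into translated cells of equal volume, so that counting
    points of mesh [h] in a set measures the union of the cells with corner in
    that set. As [h] tends to zero the volume of this union is asymptotically at
    least that of the set when it is open, and at most when it is closed and
    bounded ([count_open_lower], [count_closed_upper]). The ratio of the cell
    volumes of two commensurable meshes follows by tiling ([cell_volume_div]). *)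

(** * Coordinates on the lattice and on the space *)

(** Coordinates for the lattice and for the space at once: the integral
    coordinates of [x] are the real coordinates of [iota x]. *)
Record lattice_coordinates (R : realType) (L : zmodType) (E : lmodType R)
    (iota : {additive L -> E}) := LatticeCoordinates {
  lrank : nat;
  lbasis : 'I_lrank -> L;
  icoord : L -> {ffun 'I_lrank -> int};
  lcoord : {linear E -> 'rV[R]_lrank};
  icoordK : forall x, \sum_i lbasis i *~ icoord x i = x;
  icoord_sum : forall a : {ffun 'I_lrank -> int},
    icoord (\sum_i lbasis i *~ a i) = a;
  lcoord_iota : forall x i, lcoord (iota x) 0 i = (icoord x i)%:~R;
  lcoordK : forall v, \sum_i lcoord v 0 i *: iota (lbasis i) = v
}.
Arguments lbasis {R L E iota} c _ : rename.
Arguments icoord {R L E iota} c _ : rename.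
Arguments lcoord {R L E iota} c : rename.
Arguments lcoordK {R L E iota} c _ : rename.

(** The universal property, applied to the integral coordinates of the lattice,
    yields the real coordinates; its uniqueness part, applied to [iota] itself,
    shows that no vector is lost when it is rebuilt from its coordinates. *)
Lemma lattice_coordinates_exist (R : realType) (L : zmodType) (E : lmodType R)
    (iota : {additive L -> E}) :
  free_of_finite_rank L -> is_real_extension iota ->
  inhabited (lattice_coordinates iota).
Proof.
move=> [n [e [k ek ke]]] ext.
pose f (x : L) : 'rV[R]_n := \row_i (k x i)%:~R.
have kB x y : k (x - y) = [ffun i => k x i - k y i].
  rewrite -(ek [ffun i => k x i - k y i]); congr (k _).
  rewrite -{1}(ke x) -{1}(ke y) -sumrB; apply: eq_bigr => i _.
  by rewrite ffunE mulrzBr.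
have fB : zmod_morphism f.
  by move=> x y; apply/rowP => i; rewrite !mxE kB ffunE intrB.
pose fa : {additive L -> 'rV[R]_n} :=
  HB.pack f (GRing.isZmodMorphism.Build _ _ f fB).
have [[g gE] _] := ext _ fa.
pose h (c : 'rV[R]_n) : E := \sum_i c 0 i *: iota (e i).
have hL : linear h.
  move=> a u v; rewrite /h scaler_sumr -big_split; apply: eq_bigr => i _ /=.
  by rewrite !mxE scalerDl scalerA.
pose hl : {linear 'rV[R]_n -> E} := HB.pack h (GRing.isLinear.Build _ _ _ _ h hL).
have [_ uniq] := ext _ iota.
constructor.
apply: (@LatticeCoordinates _ _ _ _ n e k g) => [x|a|x i|v].
- exact: ke.
- exact: ek.
- by rewrite gE /= mxE.
- have := uniq (hl \o g) idfun _ _ v; apply=> //= x.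
  rewrite gE /h /= -[in RHS](ke x) raddf_sum; apply: eq_bigr => i _.
  by rewrite mxE raddfMz scaler_int.
Qed.

(** * Norms and continuity in coordinates *)

Section Topology.
Context (R : realType) (L : zmodType) (E : normedModType R).
Context (iota : {additive L -> E}) (c : lattice_coordinates iota).

Definition basis_size : R := \sum_i `|iota (lbasis c i)|.

Lemma basis_size_ge0 : 0 <= basis_size.
Proof. exact: sumr_ge0. Qed.

Lemma norm_le_coord (v : E) (t : R) :
  (forall i, `|lcoord c v 0 i| <= t) -> `|v| <= t * basis_size.
Proof.
move=> vt; rewrite -[in leLHS](lcoordK c v) mulr_sumr.
apply: le_trans (ler_norm_sum _ _ _) _.
by apply: ler_sum => i _; rewrite normrZ ler_wpM2r.
Qed.

Definition of_coord (a : 'rV[R]_(lrank c)) : E :=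
  \sum_i a 0 i *: iota (lbasis c i).

Lemma coord_of_coord a : lcoord c (of_coord a) = a.
Proof.
apply/rowP => i; rewrite /of_coord raddf_sum summxE (bigD1 i) //= linearZ mxE.
have icoord_basis j : icoord c (lbasis c j) = [ffun l => (l == j)%:Z].
  rewrite -[RHS]icoord_sum; congr (icoord c _).
  rewrite (bigD1 j) //= ffunE eqxx big1 ?addr0 // => l lj.
  by rewrite ffunE (negbTE lj).
rewrite lcoord_iota icoord_basis ffunE eqxx mulr1 big1 ?addr0 // => j ji.
by rewrite linearZ mxE lcoord_iota icoord_basis ffunE eq_sym (negbTE ji) mulr0.
Qed.

Lemma of_coord_continuous : continuous of_coord.
Proof.
apply: continuous_big => [|i _ a]; first exact: add_continuous.
apply: (@cvgZr_tmp _ _ _ (nbhs a)); exact: coord_continuous.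
Qed.

(** Equivalence of norms: on the compact unit sphere of coordinate vectors the
    norm of [E] is continuous and nonzero, hence bounded below. *)
Lemma coord_le_norm : exists2 M : R, 0 < M &
  forall v i, `|lcoord c v 0 i| <= M * `|v|.
Proof.
pose S := [set a : 'rV[R]_(lrank c) | `|a| = 1].
have cS : compact S.
  apply: bounded_closed_compact.
    by exists 1; split=> // x x1 a /= ->; exact: ltW.
  have -> : S = Num.norm @^-1` [set 1] by [].
  by apply: closed_comp => [a _|]; [exact: norm_continuous|exact: closed_eq].
have leN (a : 'rV[R]_(lrank c)) i : `|a 0 i| <= `|a|.
  rewrite [leRHS]/Num.norm /= mx_normrE; apply/bigmax_geP; right => /=.
  by exists (0, i).
have [S0|/set0P S0] := eqVneq S set0.
  (* rank zero: the sphere is empty *)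
  exists 1 => // v i; suff -> : lcoord c v = 0 by rewrite mxE normr0 mul1r.
  apply/eqP; apply: contraT => v0; suff : S (`|lcoord c v|^-1 *: lcoord c v).
    by rewrite S0.
  by rewrite /S /= normrZ normfV normr_id mulVf// normr_eq0.
have [a Sa amin] : exists2 a, a \in S & forall b, b \in S ->
    `|of_coord a| <= `|of_coord b|.
  apply: (@EVT_min_rV _ _ (fun a => `|of_coord a|)) => //.
  apply: continuous_subspaceT => a.
  by apply: continuous_comp; [exact: of_coord_continuous|exact: norm_continuous].
have a0 : 0 < `|of_coord a|.
  rewrite normr_gt0; apply: contraTneq Sa => a0; rewrite notin_setE /S /=.
  by rewrite -(coord_of_coord a) a0 raddf0 normr0 => /esym/eqP; rewrite oner_eq0.
exists (`|of_coord a|^-1); first by rewrite invr_gt0.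
move=> v i; rewrite ler_pdivlMl//; have [v0|v0] := eqVneq (lcoord c v) 0.
  by rewrite v0 mxE normr0 mulr0.
apply: le_trans (_ : `|of_coord a| * `|lcoord c v| <= _).
  by rewrite ler_wpM2l.
rewrite -ler_pdivlMr ?normr_gt0//.
apply: le_trans (amin (`|lcoord c v|^-1 *: lcoord c v) _) _.
  by rewrite inE /S /= normrZ normfV normr_id mulVf// normr_eq0.
have -> : of_coord (`|lcoord c v|^-1 *: lcoord c v) = `|lcoord c v|^-1 *: v.
  transitivity (`|lcoord c v|^-1 *: of_coord (lcoord c v)); last first.
    by rewrite /of_coord lcoordK.
  rewrite /of_coord scaler_sumr.
  by apply: eq_bigr => j _; rewrite mxE scalerA.
by rewrite normrZ normfV normr_id mulrC.
Qed.

Lemma form_coord (Phi : {scalar E}) v :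
  Phi v = \sum_i lcoord c v 0 i * Phi (iota (lbasis c i)).
Proof.
rewrite -[in LHS](lcoordK c v) raddf_sum; apply: eq_bigr => i _.
by rewrite /= scalarZ.
Qed.

Lemma coord_i_continuous i : continuous (fun v : E => lcoord c v 0 i).
Proof.
have [M M0 bM] := coord_le_norm => v.
apply/cvgrPdist_lt => e e0; near=> w.
have -> : lcoord c v 0 i - lcoord c w 0 i = lcoord c (v - w) 0 i.
  by rewrite raddfB !mxE.
apply: le_lt_trans (bM _ _) _; rewrite -ltr_pdivlMl//.
near: w; apply: cvgr_dist_lt => //.
by rewrite mulr_gt0// invr_gt0.
Unshelve. all: by end_near. Qed.

Lemma form_continuous (Phi : {scalar E}) : continuous Phi.
Proof.
have -> : Phi =
    (fun v => \sum_i lcoord c v 0 i * Phi (iota (lbasis c i))) :> (E -> R).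
  by apply/funext => v; rewrite form_coord.
apply: continuous_big => [|i _ v]; first exact: add_continuous.
by apply: (@cvgMr_tmp _ _ (nbhs v)); exact: coord_i_continuous.
Qed.

End Topology.

(** * Finiteness of the separating hyperplanes *)

(** The generator is the least positive value, found by minimising the
    interval of length [delta] in which it lies: two values in the same
    interval differ by less than [delta], hence coincide. *)
Lemma discrete_image_cyclic (R : realType) (L : zmodType) (f : {additive L -> R})
    (delta : R) :
  0 < delta -> (forall x, 0 < f x -> delta <= f x) -> (exists x, 0 < f x) ->
  exists2 x0, 0 < f x0 & forall x, exists k : int, f x = f x0 * k%:~R.
Proof.
move=> delta0 fdelta [x1 fx1].
pose P n := `[< exists2 x, 0 < f x & f x <= delta *+ n >].
have exP : exists n, P n.
  exists (`|Num.ceil (f x1 / delta)|%N); apply/asboolP; exists x1 => //.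
  rewrite -mulr_natr mulrC -ler_pdivrMr// natr_absz ger0_norm ?ceil_ge//.
  by rewrite ltW// ceil_gt0 divr_gt0.
have [N /asboolP[x0 fx0 fx0N] Nmin] := ex_minnP exP.
have {}Nmin x : 0 < f x -> f x0 <= f x.
  move=> fx; rewrite leNgt; apply/negP => xx0.
  have := fdelta (x0 - x); rewrite raddfB subr_gt0 xx0 => /(_ isT) le_delta.
  case: N fx0N Nmin => [|N] fx0N Nmin.
    by rewrite mulr0n leNgt fx0 in fx0N.
  suff /Nmin : P N by rewrite ltnn.
  apply/asboolP; exists x => //; rewrite mulrS in fx0N.
  by move: fx0N le_delta; lra.
exists x0 => // x; exists (Num.floor (f x / f x0)).
set k := Num.floor _.
have fk : f (x - x0 *~ k) = f x - f x0 * k%:~R by rewrite raddfB raddfMz mulrzr.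
have k_le : f x0 * k%:~R <= f x by rewrite mulrC -ler_pdivlMr// floor_le.
have lt_k : f x < f x0 * k%:~R + f x0.
  rewrite -[X in _ < _ + X]mulr1 -mulrDr mulrC -ltr_pdivrMr//.
  by rewrite (_ : _ + 1 = (Num.floor (f x / f x0) + 1)%:~R) ?floorD1_gt// intrD.
move: k_le; rewrite le_eqVlt => /predU1P[->//|k_lt].
have := Nmin (x - x0 *~ k); rewrite fk subr_gt0 => /(_ k_lt); lra.
Qed.

Section Separating.
Context (R : realType) (L : zmodType) (E : lmodType R).
Context (iota : {additive L -> E}) (c : lattice_coordinates iota) (d : nat).
Context (m : cosets L d -> nat) (r : cosets L d -> L).
Hypothesis d_gt1 : (1 < d)%N.
Hypothesis data : collatz_data m r.
Hypothesis coprime_m : relatively_prime_type m.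

Let basis_coset i := coset_of d (lbasis c i).

Lemma additive_basis0 (f : {additive L -> R}) :
  (forall i, f (lbasis c i) = 0) -> forall x, f x = 0.
Proof.
move=> f0 x; rewrite -(icoordK c x) raddf_sum big1// => i _.
by rewrite raddfMz f0 mul0rz.
Qed.

(** The shifts of the cosets of the basis vectors are [d y_i - m_i e_i]; modulo
    [d] their coordinate matrix is diagonal with invertible entries, so its
    determinant is nonzero and the shifts span the space. *)
Lemma shifts_span (f : {additive L -> R}) :
  (forall i, f (r (basis_coset i)) = 0) -> forall x, f x = 0.
Proof.
move=> fr0; apply: additive_basis0.
have /choice[y yE] : forall i, exists y,
    lbasis c i *+ m (basis_coset i) + r (basis_coset i) = y *+ d.
  by move=> i; apply: data.2.
pose A : 'M[int]_(lrank c) :=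
  \matrix_(i, j) (icoord c (y i) j *+ d - (m (basis_coset i))%:Z *+ (i == j)).
have detA : \det A != 0.
  apply/eqP => detA0.
  have : \det (map_mx intr A : 'M['Z_d]_(lrank c)) = 0.
    by rewrite det_map_mx detA0.
  have -> : map_mx intr A =
      diag_mx (\row_i (- (m (basis_coset i))%:R)) :> 'M['Z_d]_(lrank c).
    apply/matrixP => i j; rewrite !mxE intrB !rmorphMn /= -mulr_natr pchar_Zp//.
    by rewrite mulr0 sub0r mulNrn.
  rewrite det_diag => det0.
  have : \prod_i (\row_i (- (m (basis_coset i))%:R : 'Z_d)) 0 i \is a GRing.unit.
    apply: rpred_prod => i _; rewrite mxE unitrN unitZpE//.
    by rewrite /coprime coprime_m.
  by rewrite det0 unitr0.
pose u : 'cV[R]_(lrank c) := \col_i f (lbasis c i).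
have Au0 : map_mx intr A *m u = 0.
  apply/colP => i; rewrite !mxE.
  have fy : f (y i) = \sum_j (icoord c (y i) j)%:~R * f (lbasis c j).
    rewrite -{1}(icoordK c (y i)) raddf_sum; apply: eq_bigr => j _.
    by rewrite raddfMz mulrzl.
  have := congr1 f (yE i); rewrite raddfD !raddfMn /= fr0 addr0 => fm.
  transitivity (f (y i) *+ d - f (lbasis c i) *+ m (basis_coset i)); last first.
    by rewrite fm subrr.
  rewrite fy -mulr_natl mulr_sumr.
  rewrite [X in _ - X](_ : _ =
      \sum_j (m (basis_coset i))%:R *+ (i == j) * f (lbasis c j)).
    rewrite -sumrB; apply: eq_bigr => j _; rewrite !mxE intrB !rmorphMn /=.
    by rewrite -mulr_natl; ring.
  rewrite (bigD1 i)//= eqxx mulr1n mulr_natl big1 ?addr0// => j ji.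
  by rewrite eq_sym (negbTE ji) mulr0n mul0r.
have Aunit : (map_mx intr A : 'M[R]_(lrank c)) \in unitmx.
  by rewrite unitmxE det_map_mx unitfE intr_eq0.
move=> i; have := mulKmx Aunit u; rewrite Au0 mulmx0 => /colP/(_ i).
by rewrite !mxE.
Qed.


(** Moving along [d x], the coset [w] is reached at a point where the form
    takes a value in the interval from [0] (excluded) to [d Phi(x)]; separation
    at that point gives the bound. *)
Lemma separating_shift_lt (Phi : {scalar E}) w x :
  separating_form iota m r Phi -> 0 < Phi (iota x) ->
  `|Phi (iota (r w))| < (m w * d)%:R * Phi (iota x).
Proof.
move=> [_ sep] gx; set g := Phi (iota x) in gx *.
have d0 : 0 < (d%:R : R) by rewrite ltr0n ltnW.
pose x0 : L := repr w; set t := Phi (iota x0).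
pose k : int := 1 - Num.ceil (t / (d%:R * g)).
pose x1 : L := x0 + x *+ d *~ k.
have Phi_shift (j : int) :
    Phi (iota (x0 + x *+ d *~ j)) = t + d%:R * g * j%:~R.
  by rewrite !raddfD /= !raddfMz !raddfMn mulr_natl mulrzr.
have Phi1 : Phi (iota x1) = t + d%:R * g * k%:~R by exact: Phi_shift.
have dg : 0 < d%:R * g by rewrite mulr_gt0.
have tE : t = t / (d%:R * g) * (d%:R * g) by rewrite divfK// gt_eqF.
have := ceil_itv (t / (d%:R * g)); rewrite intrB => /andP[lo hi].
have x1_gt0 : 0 < Phi (iota x1).
  rewrite Phi1 tE mulrC -mulrDr mulr_gt0// /k intrB; move: lo; lra.
have x1_le : Phi (iota x1) <= d%:R * g.
  rewrite Phi1 tE mulrC -mulrDr ger_pMr// /k intrB; move: hi; lra.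
have x1w : coset_of d x1 = w.
  rewrite -[RHS]reprK; apply/eqmodP/asboolP; exists (x *~ k).
  by rewrite /x1 addrC addKr !pmulrn mulrzAC.
have := sep w x1 x1w; rewrite gt_eqF// => /(_ isT) /lt_le_trans; apply.
by rewrite normrM normr_nat (gtr0_norm x1_gt0) natrM -mulrA ler_wpM2l.
Qed.

Lemma nontrivial_lattice (Phi : {scalar E}) :
  nontrivial_form Phi -> exists x, 0 < Phi (iota x).
Proof.
move=> [v Phiv]; apply: contrapT => /forallNP Phi_le0.
have Phi0 x : Phi (iota x) = 0.
  apply/eqP; rewrite eq_le !leNgt; apply/andP; split; apply/negP => Phix.
    exact: Phi_le0 x Phix.
  by apply: (Phi_le0 (- x)); rewrite !raddfN oppr_gt0.
move: Phiv; rewrite -(lcoordK c v) raddf_sum big1 ?eqxx// => i _.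
by rewrite /= scalarZ Phi0 mulr0.
Qed.

(** By [separating_shift_lt] the positive values of a separating form on the
    lattice are bounded below, since some shift has a nonzero value. The values
    therefore form a cyclic group, and in units of its generator [a] the values
    on the shifts are integers bounded independently of the form. *)
Lemma separating_integral (Phi : {scalar E}) :
  separating_form iota m r Phi ->
  exists2 a : R, 0 < a & forall i, exists z : int,
    Phi (iota (r (basis_coset i))) = a * z%:~R /\
    (`|z| < m (basis_coset i) * d)%N.
Proof.
move=> sep; pose f : {additive L -> R} := Phi \o iota.
have [x fx] := nontrivial_lattice sep.1.
have [i fri] : exists i, f (r (basis_coset i)) != 0.
  apply/not_existsP => fr0; move: fx; rewrite -[Phi _]/(f x) shifts_span ?ltxx//.
  by move=> i; apply/eqP/negPn/negP/fr0.
have md0 j : 0 < ((m (basis_coset j) * d)%:R : R).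
  by rewrite ltr0n muln_gt0 data.1 ltnW.
have [] := @discrete_image_cyclic _ _ f
    (`|f (r (basis_coset i))| / (m (basis_coset i) * d)%:R).
- by rewrite divr_gt0// normr_gt0.
- move=> y fy; rewrite ltW// ltr_pdivrMr// mulrC.
  exact: separating_shift_lt.
- by exists x.
move=> x0 fx0 fE; exists (f x0) => // j; have [z zE] := fE (r (basis_coset j)).
exists z; split=> //; have := separating_shift_lt (basis_coset j) sep fx0.
rewrite -[Phi (iota (r _))]/(f (r _)) zE normrM (gtr0_norm fx0) mulrC ltr_pM2r//.
rewrite -intr_norm -[(m _ * d)%:R]/((m (basis_coset j) * d)%N%:Z%:~R) ltr_int.
by lia.
Qed.

(** A separating form is determined, up to a positive factor, by bounded
    integers: its values on the spanning shifts in the unit of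
    [separating_integral]. One form is chosen for each possible list. *)
Lemma separating_forms_finite : exists (I : finType) (F : I -> {scalar E}),
  (forall i, separating_form iota m r (F i)) /\
  forall Phi, separating_form iota m r Phi ->
    exists i, exists2 a, 0 < a & forall v, Phi v = a * F i v.
Proof.
pose B := (\sum_i m (basis_coset i) * d)%N.
(* in units of a, the value of the form on the i-th shift is k i - B *)
pose K (k : {ffun 'I_(lrank c) -> 'I_(B + B).+1}) (Phi : {scalar E}) :=
  separating_form iota m r Phi /\ exists2 a : R, 0 < a &
    forall i, Phi (iota (r (basis_coset i))) = a * ((k i)%:R - B%:R).
pose I := {k | `[< exists Phi, K k Phi >]}.
have Kex (k : I) : exists Phi, K (val k) Phi by apply/asboolP; exact: (valP k).
exists I, (fun k => projT1 (cid (Kex k))); split.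
  by move=> k; case: cid => Phi [].
move=> Phi sep; have [a a0 /choice[z zP]] := separating_integral sep.
have z_lt i : (`|z i| < B)%N.
  by apply: leq_trans (zP i).2 _; rewrite /B (bigD1 i)//= leq_addr.
pose k : {ffun 'I_(lrank c) -> 'I_(B + B).+1} := [ffun i => inord `|z i + B|].
have kE i : (k i)%:R - B%:R = (z i)%:~R :> R.
  have ziB := z_lt i; rewrite ffunE inordK; last by lia.
  rewrite natr_absz ger0_norm; last by lia.
  by rewrite intrD addrK.
have Kk : K k Phi.
  by split=> //; exists a => // i; rewrite kE (zP i).1.
have Ik : `[< exists Phi, K k Phi >] by apply/asboolP; exists Phi.
exists (exist _ k Ik); case: cid => /= Psi [sepPsi [b b0 PsiE]].
exists (a / b); first exact: divr_gt0.
pose D x := Phi (iota x) - a / b * Psi (iota x).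
have DB : zmod_morphism D.
  by move=> x y; rewrite /D !raddfB /=; ring.
pose Da : {additive L -> R} := HB.pack D (GRing.isZmodMorphism.Build _ _ D DB).
have D0 : forall x, Da x = 0.
  apply: shifts_span => i; rewrite /= /D PsiE (zP i).1 kE.
  by rewrite mulrA divfK ?gt_eqF// subrr.
move=> v; rewrite -(lcoordK c v) !raddf_sum mulr_sumr; apply: eq_bigr => i _.
rewrite /= !scalarZ mulrCA; congr (_ * _).
by apply/eqP; rewrite -subr_eq0; apply/eqP; exact: D0.
Qed.

End Separating.

(** * Trajectories and the cone of the shifts *)

Lemma same_sign_trans (R : realDomainType) (a b c : R) :
  0 < a * b -> 0 < b * c -> 0 < a * c.
Proof.
move=> ab bc; have b0 : b != 0 by apply: contraTneq ab => ->; rewrite mulr0 ltxx.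
rewrite -(pmulr_lgt0 _ (_ : 0 < b ^+ 2)) ?exprn_even_gt0//.
have -> : a * c * b ^+ 2 = (a * b) * (b * c) by ring.
exact: mulr_gt0.
Qed.

Lemma dominated_sign (R : realDomainType) (a b : R) :
  `|b| < `|a| -> 0 < (a + b) * a.
Proof.
move=> ba; have [a0|a0] := ler0P a; move: ba.
  rewrite (ler0_norm a0) ltr_norml opprK => /andP[ab ba].
  by rewrite nmulr_lgt0; lra.
rewrite (gtr0_norm a0) ltr_norml => /andP[ab ba].
by rewrite pmulr_lgt0; lra.
Qed.

Section ShiftCone.
Context (R : realType) (L : zmodType) (E : lmodType R) (iota : {additive L -> E}).
Context (d : nat) (m : cosets L d -> nat) (r : cosets L d -> L) (T : L -> L).
Hypothesis d_gt1 : (1 < d)%N.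
Hypothesis coprime_m : relatively_prime_type m.
Hypothesis data : collatz_data m r.
Hypothesis collatzT : collatz_mapping m r T.

Definition nonneg_on_shifts (Phi : {scalar E}) : Prop :=
  nontrivial_form Phi /\ forall w, 0 <= Phi (iota (r w)).

Lemma cone_plusP v : cone_plus (shift_vectors iota r) v <->
  forall Phi, nonneg_on_shifts Phi -> 0 <= Phi v.
Proof.
split=> [vB Phi [nt Phi_ge0]|vB H [[Phi [nt ->]] SH] /=].
  apply: (vB [set v | 0 <= Phi v]); split; first by exists Phi.
  by move=> _ [w _ <-]; exact: Phi_ge0.
by apply: vB; split=> // w; apply: SH; exists w.
Qed.

Lemma cone_minusP v : cone_minus (shift_vectors iota r) v <->
  forall Phi, nonneg_on_shifts Phi -> Phi v <= 0.
Proof.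
split=> [[u /cone_plusP uB <-] Phi /uB|vB]; first by rewrite raddfN oppr_le0.
exists (- v); last exact: opprK.
by apply/cone_plusP => Phi /vB; rewrite raddfN oppr_ge0.
Qed.

Lemma cone_plusDZ v w t : cone_plus (shift_vectors iota r) v -> 0 <= t ->
  cone_plus (shift_vectors iota r) (v + t *: iota (r w)).
Proof.
move=> /cone_plusP vB t0; apply/cone_plusP => Phi nnPhi.
by rewrite raddfD /= scalarZ addr_ge0 ?vB// mulr_ge0// nnPhi.2.
Qed.

Lemma cone_minusZ v t : cone_minus (shift_vectors iota r) v -> 0 <= t ->
  cone_minus (shift_vectors iota r) (t *: v).
Proof.
move=> /cone_minusP vB t0; apply/cone_minusP => Phi nnPhi.
by rewrite scalarZ mulr_ge0_le0// vB.
Qed.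

Lemma form_step (Phi : {scalar E}) x (w := coset_of d x) :
  d%:R * Phi (iota (T x)) = (m w)%:R * Phi (iota x) + Phi (iota (r w)).
Proof.
have := congr1 (Phi \o iota) (collatzT (erefl (coset_of d x))).
by rewrite raddfD !raddfMn /= !mulr_natl.
Qed.

(** Iterating, [d^k T^k(x)] is [M x] plus a nonnegative combination of shifts,
    where [M] is a product of multipliers. *)
Lemma form_iter k x : exists2 M, coprime d M & forall Phi, nonneg_on_shifts Phi ->
  M%:R * Phi (iota x) <= (d ^ k)%:R * Phi (iota (iter k T x)).
Proof.
elim: k => [|k [M cM ih]]; first by exists 1%N; rewrite ?coprimen1.
pose y := iter k T x; exists (m (coset_of d y) * M)%N.
  by rewrite coprimeMr cM /coprime coprime_m.
move=> Phi nnPhi; rewrite iterS expnSr !natrM -[in leRHS]mulrA form_step.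
rewrite mulrDr ler_wpDr ?mulr_ge0 ?nnPhi.2//.
by rewrite mulrCA -mulrA ler_wpM2l// ih.
Qed.

(** If [T^p(y) = y] then [(d^p - M) y] lies in the cone of the shifts, and
    [d^p <> M] because [M] is prime to [d]; the sign of [d^p - M] decides
    between the cone and its opposite. *)
Lemma periodic_in_cone y p : (0 < p)%N -> iter p T y = y ->
  cone_plus (shift_vectors iota r) (iota y) \/
  cone_minus (shift_vectors iota r) (iota y).
Proof.
move=> p0 yp; have [M cM] := form_iter p y; rewrite yp => MP.
have ineq Phi : nonneg_on_shifts Phi ->
    0 <= ((d ^ p)%:R - M%:R) * Phi (iota y).
  by move=> /MP; rewrite mulrBl subr_ge0.
have [lt|lt|Mdp] := ltngtP M (d ^ p).
- left; apply/cone_plusP => Phi /ineq.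
  by rewrite pmulr_rge0// subr_gt0 ltr_nat.
- right; apply/cone_minusP => Phi /ineq.
  by rewrite nmulr_rge0// subr_lt0 ltr_nat.
- by move: cM; rewrite Mdp coprime_pexpr// /coprime gcdnn gtn_eqF.
Qed.

Lemma cone_minus_iter x k : cone_minus (shift_vectors iota r) (iota (iter k T x)) ->
  cone_minus (shift_vectors iota r) (iota x).
Proof.
move=> /cone_minusP TxB; have [M cM MP] := form_iter k x.
have M0 : (0 < M)%N.
  rewrite lt0n; apply: contraTneq cM => ->.
  by rewrite /coprime gcdn0 gtn_eqF.
apply/cone_minusP => Phi nnPhi; have := MP _ nnPhi.
rewrite -(pmulr_rle0 _ (_ : 0 < M%:R)) ?ltr0n// => /le_trans; apply.
by rewrite mulr_ge0_le0// TxB.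
Qed.

(** Separation says that the shift cannot change the sign of a nonzero value,
    so this sign is constant along a trajectory. *)
Lemma separating_sign (Phi : {scalar E}) x k :
  separating_form iota m r Phi -> Phi (iota x) != 0 ->
  0 < Phi (iota (iter k T x)) * Phi (iota x).
Proof.
move=> [_ sep] Phix; elim: k => [|k ih] /=.
  by rewrite -expr2 exprn_even_gt0.
set y := iter k T x in ih *.
have Phiy : Phi (iota y) != 0 by apply: contraTneq ih => ->; rewrite mul0r ltxx.
apply: same_sign_trans ih.
have d0 : 0 < (d%:R : R) by rewrite ltr0n ltnW.
rewrite -(pmulr_rgt0 _ d0) mulrA form_step.
have m0 : 0 < ((m (coset_of d y))%:R : R) by rewrite ltr0n data.1.
rewrite -(pmulr_rgt0 _ m0) mulrCA; apply: dominated_sign.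
exact: sep.
Qed.

End ShiftCone.

Lemma small_perturbation (R : realType) (E : lmodType R) (I : finType)
    (F : I -> {scalar E}) (w u : E) : exists2 t, 0 < t &
  forall i, F i w != 0 -> 0 < F i (w + t *: u) * F i w.
Proof.
near (0 : R)^'+ => t; exists t => // i Fw.
suff lt_t : t * `|F i u| < `|F i w|.
  rewrite raddfD /= scalarZ; apply: dominated_sign.
  by rewrite normrM gtr0_norm.
have ti : t < `|F i w| / (`|F i u| + 1).
  move: i Fw; near: t; apply: filter_forall => i.
  have [->|Fw] := eqVneq (F i w) 0; first by near=> t.
  near=> t => _; near: t; apply: nbhs_right_lt.
  by rewrite divr_gt0 ?normr_gt0// ltr_wpDl.
move: ti; rewrite ltr_pdivlMr ?ltr_wpDl// mulrDr mulr1; apply: le_lt_trans.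
by rewrite lerDl.
Unshelve. all: by end_near. Qed.

(** * Chambers, the wild cone and divergence *)

Section Chambers.
Context (R : realType) (L : zmodType) (E : normedModType R).
Context (iota : {additive L -> E}) (c : lattice_coordinates iota) (d : nat).
Context (m : cosets L d -> nat) (r : cosets L d -> L) (T : L -> L).
Hypothesis d_gt1 : (1 < d)%N.
Hypothesis data : collatz_data m r.
Hypothesis coprime_m : relatively_prime_type m.
Hypothesis collatzT : collatz_mapping m r T.

Local Notation Bplus := (cone_plus (shift_vectors iota r)).
Local Notation Bminus := (cone_minus (shift_vectors iota r)).
Local Notation separating := (separating_form iota m r).
Local Notation A := (hyperplane_complement iota m r).

(** For [w] off the separating hyperplanes this is the closure of the component
    of [w], see [closure_component]; with linear inequalities instead of a
    closure, invariance under dilations and closedness are immediate. *)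
Definition closed_chamber (w : E) : set E :=
  [set v | forall Phi, separating Phi -> 0 <= Phi v * Phi w].

Lemma complementP v : A v <-> forall Phi, separating Phi -> Phi v != 0.
Proof.
split=> [Av Phi sep|Av [H [Phi [sep ->]] /= Phiv]].
  apply/eqP => Phiv; apply: Av; exists [set u | Phi u = 0] => //.
  by exists Phi.
by have := Av _ sep; rewrite Phiv eqxx.
Qed.

(** A connected set avoiding the hyperplanes cannot change the sign of a
    separating form, by the intermediate value theorem; conversely, points on
    the same side of all hyperplanes are joined by a segment. *)
Lemma component_chamber x : A x -> connected_component A x =
  [set v | forall Phi, separating Phi -> 0 < Phi v * Phi x].
Proof.
move=> Ax; apply/seteqP; split=> [v [C [Cx CA cC] Cv] Phi sep|v xv].
  have cPhi : connected (Phi @` C).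
    apply: connected_continuous_connected => //.
    by apply: continuous_subspaceT; exact: (form_continuous c).
  have PhiC u : C u -> Phi u != 0 by move=> /CA /complementP/(_ _ sep).
  rewrite ltNge; apply/negP => vx; move/connected_intervalP: cPhi => itvPhi.
  have Phix := PhiC _ Cx.
  have {}vx : Phi v * Phi x < 0.
    by rewrite lt_neqAle vx mulf_neq0// PhiC.
  suff [u Cu Phiu] : (Phi @` C) 0 by have := PhiC _ Cu; rewrite Phiu eqxx.
  have [x0|x0|x0] := ltrgt0P (Phi x).
  - apply: (itvPhi (Phi v) (Phi x)); [by exists v|by exists x|].
    by move: vx; rewrite pmulr_llt0// (ltW x0) andbT => /ltW.
  - apply: (itvPhi (Phi x) (Phi v)); [by exists x|by exists v|].
    by move: vx; rewrite nmulr_llt0// (ltW x0) => /ltW.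
  - by rewrite x0 eqxx in Phix.
pose f (t : R) : E := x + t *: (v - x).
have fc : continuous f.
  move=> t; apply: cvgD; first exact: cvg_cst.
  by apply: cvgZr_tmp.
exists (f @` `[0, 1]); last first.
  by exists 1; rewrite /f ?scale1r ?subrKC//= in_itv/= ler01 lexx.
split.
- by exists 0; rewrite /f ?scale0r ?addr0//= in_itv/= ler01 lexx.
- move=> _ [t /= t01 <-]; apply/complementP => Phi sep.
  move: t01; rewrite in_itv /= => /andP[t0 t1].
  have xx : 0 < Phi x * Phi x.
    by rewrite -expr2 exprn_even_gt0//; move/complementP: Ax; apply.
  have vx := xv _ sep.
  suff : 0 < Phi (f t) * Phi x by apply: contraTneq => ->; rewrite mul0r ltxx.
  have -> : Phi (f t) * Phi x = (1 - t) * (Phi x * Phi x) + t * (Phi v * Phi x).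
    by rewrite /f raddfD /= scalarZ raddfB /=; ring.
  have [->|t_neq0] := eqVneq t 0; first by rewrite subr0 mul1r mul0r addr0.
  have {}t0 : 0 < t by rewrite lt_def t_neq0.
  by rewrite ltr_wpDl ?(mulr_gt0 t0 vx)// mulr_ge0 ?subr_ge0// (ltW xx).
- apply: connected_continuous_connected; first exact: segment_connected.
  exact: continuous_subspaceT.
Qed.

Lemma closed_chamber_closed w : closed (closed_chamber w).
Proof.
have -> : closed_chamber w =
    \bigcap_(Phi in [set Phi | separating Phi]) [set v | 0 <= Phi v * Phi w].
  by [].
apply: closed_bigI => Phi sep.
apply: (@closed_comp _ _ (fun v => Phi v * Phi w) [set t | 0 <= t]) => [v _|].
  by apply: cvgMr_tmp; exact: (form_continuous c).
exact: closed_ge.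
Qed.

Lemma closure_component x : A x ->
  closure (connected_component A x) = closed_chamber x.
Proof.
move=> Ax; rewrite component_chamber//; apply/seteqP; split=> [v|v vx].
  rewrite closureE; apply; split; first exact: closed_chamber_closed.
  by move=> u ux Phi sep; apply: ltW; exact: ux.
have fc : v + t *: x @[t --> (0:R)] --> v.
  rewrite -[X in _ --> X]addr0 -(scale0r x).
  by apply: cvgD; [exact: cvg_cst|exact: cvgZr_tmp].
move=> B vB; have /nbhs_ballP[e /= e0 eB] := fc _ vB.
exists (v + (e / 2) *: x); split; last first.
  apply: (eB (e / 2)); rewrite /ball /= sub0r normrN gtr0_norm ?divr_gt0//.
  by rewrite ltr_pdivrMr// ltr_pMr// ltr1n.
move=> Phi sep; rewrite raddfD /= scalarZ mulrDl -mulrA ltr_wpDl//.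
  exact: vx.
rewrite mulr_gt0 ?divr_gt0// -expr2 exprn_even_gt0//.
by move/complementP: Ax; apply.
Qed.

(** Since the shifts span, every separating form is nonzero on some shift, and
    a small multiple of that shift moves [y] off the hyperplane without leaving
    the cone or crossing another hyperplane. There are finitely many forms to
    treat. *)
Lemma generic_cone_point y : Bplus y ->
  exists w, [/\ A w, Bplus w & closed_chamber w y].
Proof.
move=> yB.
have [I [F [sepF FP]]] := separating_forms_finite c d_gt1 data coprime_m.
have FS i : exists w, F i (iota (r w)) != 0.
  apply: contrapT => /forallNP F0.
  have [x] := nontrivial_lattice c (sepF i).1.
  rewrite (_ : F i (iota x) = 0) ?ltxx//.
  pose f : {additive L -> R} := F i \o iota.
  apply: (shifts_span (c := c) d_gt1 data coprime_m (f := f)) => j.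
  by apply/eqP/negPn/negP/F0.
have [w [wB wF wy]] : exists w, [/\ Bplus w,
    forall i, i \in enum I -> F i w != 0 &
    forall i, F i y != 0 -> 0 < F i w * F i y].
  elim: (enum I) => [|j s [w [wB ws wy]]].
    by exists y; split=> // i Fy; rewrite -expr2 exprn_even_gt0.
  have [u Fu] := FS j; have [t t0 wt] := small_perturbation F w (iota (r u)).
  exists (w + t *: iota (r u)); split=> [|i|i /wy Fwy].
  - by apply: cone_plusDZ => //; exact: ltW.
  - have [Fw|Fw] := eqVneq (F i w) 0; last first.
      by move=> _; apply: contraTneq (wt i Fw) => ->; rewrite mul0r ltxx.
    rewrite inE => /predU1P[ij|/ws]; last by rewrite Fw eqxx.
    by rewrite raddfD /= scalarZ Fw add0r mulf_neq0 ?(gt_eqF t0)// ij.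
  - apply: (same_sign_trans _ Fwy); apply: wt.
    by apply: contraTneq Fwy => ->; rewrite mul0r ltxx.
exists w; split=> //.
  apply/complementP => Phi /FP[i [a a0 ->]].
  by rewrite mulf_neq0 ?(gt_eqF a0)// wF// mem_enum.
move=> Phi /FP[i [a a0 PhiE]]; rewrite !PhiE mulrACA pmulr_rge0 ?mulr_gt0//.
have [->|/wy/ltW] := eqVneq (F i y) 0; first by rewrite mul0r.
by rewrite mulrC.
Qed.

Lemma wild_coneE : wild_cone iota m r =
  Bminus `|` \bigcup_(w in A `&` Bplus) closed_chamber w.
Proof.
congr (_ `|` _); apply/seteqP; split=> v.
  move=> [C [[x Ax <-] [w [xw wB]]]].
  have Aw := connected_component_sub xw.
  have -> : connected_component A x = connected_component A w.
    by apply: same_connected_component.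
  by rewrite closure_component// => vw; exists w.
move=> [w [Aw wB] vw]; exists (connected_component A w).
  split; first by exists w.
  by exists w; split=> //; exact: connected_component_refl.
by rewrite closure_component.
Qed.

(** An eventually periodic trajectory reaches a periodic point [y] of the cone
    or of its opposite. In the latter case [x] is in the opposite cone as well.
    In the former, [y] lies in the closed chamber of a point [w] of the cone off
    the hyperplanes; the forms that do not vanish at [x] have the same sign at
    [x] and at [y], so [x] is in that wild closed chamber too. *)
Lemma tame_divergent x : tame_cone iota m r (iota x) -> divergent T x.
Proof.
rewrite /tame_cone wild_coneE => tame [N [p [p0 per]]]; apply: tame.
set y := iter N T x.
have yp : iter p T y = y by rewrite -iterD addnC per.
have [yB|yB] := periodic_in_cone iota d_gt1 coprime_m collatzT p0 yp; last first.
  by left; exact: cone_minus_iter yB.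
have [w [Aw wB yw]] := generic_cone_point yB; right; exists w => // Phi sep.
have [->|Phix] := eqVneq (Phi (iota x)) 0; first by rewrite mul0r.
have xy := separating_sign d_gt1 data collatzT N sep Phix.
have := yw _ sep; rewrite le_eqVlt => /predU1P[/esym/eqP|yw0].
  rewrite mulf_eq0 => /orP[/eqP Phiy|/eqP->]; last by rewrite mulr0.
  by move: xy; rewrite -/y Phiy mul0r ltxx.
by apply: ltW; apply: same_sign_trans yw0; rewrite mulrC.
Qed.

(** Up to positive factors there are finitely many separating forms, hence
    finitely many sign patterns and finitely many closed chambers. *)
Lemma wild_cone_closed : closed (wild_cone iota m r).
Proof.
rewrite wild_coneE; apply: closedU.
  have -> : Bminus = \bigcap_(Phi in [set Phi | nonneg_on_shifts iota r Phi])
      [set v | Phi v <= 0].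
    by apply/seteqP; split=> v /cone_minusP.
  apply: closed_bigI => Phi _.
  apply: (@closed_comp _ _ Phi [set t | t <= 0]) => [v _|].
    exact: (form_continuous c).
  exact: closed_le.
have [I [F [sepF FP]]] := separating_forms_finite c d_gt1 data coprime_m.
pose sgn w : {ffun I -> bool} := [ffun i => 0 < F i w].
have chamberE w : A w -> closed_chamber w =
    [set v | forall i, 0 <= F i v * (-1) ^+ (~~ sgn w i)].
  move=> Aw; have Fw i : F i w != 0 by move/complementP: Aw; apply.
  have Fsgn i v : (0 <= F i v * F i w) = (0 <= F i v * (-1) ^+ (~~ sgn w i)).
    rewrite ffunE; have [w0|w0] := ltrP 0 (F i w).
      by rewrite expr0 mulr1 pmulr_lge0.
    by rewrite expr1 mulrN1 oppr_ge0 nmulr_lge0// lt_neqAle Fw.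
  apply/seteqP; split=> v vw => [i|Phi /FP[i [a a0 PhiE]]].
    by rewrite -Fsgn; exact: vw.
  by rewrite !PhiE mulrACA pmulr_rge0 ?mulr_gt0// Fsgn.
rewrite (_ : \bigcup_(w in _) _ = \bigcup_(s in sgn @` (A `&` Bplus))
    [set v | forall i, 0 <= F i v * (-1) ^+ (~~ s i)]).
  apply: closed_bigcup => [|s [w [Aw _] <-]].
    exact: finite_finset.
  by rewrite -chamberE//; exact: closed_chamber_closed.
rewrite bigcup_image; apply: eq_bigcupr => w [Aw _]; exact: chamberE.
Qed.

Lemma wild_coneZ v t : 0 <= t -> wild_cone iota m r v ->
  wild_cone iota m r (t *: v).
Proof.
move=> t0; rewrite wild_coneE => -[vB|[w AwB vw]].
  by left; exact: cone_minusZ.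
by right; exists w => // Phi sep; rewrite scalarZ -mulrA mulr_ge0// vw.
Qed.

End Chambers.

(** * Rounding to a lattice of small mesh *)

Section Tiles.
Context (R : realType) (L : zmodType) (E : normedModType R).
Context (iota : {additive L -> E}) (c : lattice_coordinates iota).
Local Notation n := (lrank c).

(** The corner of the half-open cell of the lattice of mesh [h] that contains
    [v], expressed as an element of [L]. *)
Definition lround (h : R) (v : E) : L :=
  \sum_i lbasis c i *~ Num.floor (lcoord c v 0 i / h).

Lemma icoord_lround h v i :
  icoord c (lround h v) i = Num.floor (lcoord c v 0 i / h).
Proof.
pose a := [ffun j => Num.floor (lcoord c v 0 j / h)].
have -> : lround h v = \sum_j lbasis c j *~ a j.
  by apply: eq_bigr => j _; rewrite ffunE.
by rewrite icoord_sum ffunE.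
Qed.

Lemma icoord_inj (x y : L) : icoord c x =1 icoord c y -> x = y.
Proof.
move=> xy; rewrite -(icoordK c x) -(icoordK c y).
by apply: eq_bigr => i _; rewrite xy.
Qed.

Lemma lround_near h v : 0 < h ->
  `|h *: iota (lround h v) - v| <= h * basis_size c.
Proof.
move=> h0; apply: norm_le_coord => i.
rewrite raddfB /= linearZ !mxE /= lcoord_iota icoord_lround distrC.
set t := lcoord c v 0 i; have /andP[lo hi] := floor_itv (t / h).
rewrite ler_pdivlMr// mulrC in lo; rewrite ltr_pdivrMr// intrD in hi.
rewrite ger0_norm ?subr_ge0//; move: hi; rewrite mulrDl mul1r; lra.
Qed.

Lemma lround_shift h x v : 0 < h ->
  lround h (h *: iota x + v) = x + lround h v.
Proof.
move=> h0; rewrite -{2}(icoordK c x) /lround -big_split; apply: eq_bigr => i _ /=.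
rewrite -mulrzDr; congr (_ *~ _); rewrite raddfD /= linearZ !mxE lcoord_iota.
by rewrite mulrDl mulrAC divff ?gt_eqF// mul1r floorDzr ?intr_int// intrKfloor.
Qed.

Lemma lround_fiber h (x : L) : 0 < h ->
  lround h @^-1` [set x] = [set h *: iota x + v | v in lround h @^-1` [set 0]].
Proof.
move=> h0; apply/seteqP; split=> v /=.
  move=> vx; exists (v - h *: iota x); last by rewrite addrC subrK.
  have := lround_shift x (v - h *: iota x) h0.
  by rewrite addrC subrK vx -{1}[x]addr0 => /addrI /esym.
by move=> [u u0 <-]; rewrite lround_shift// u0 addr0.
Qed.

Lemma lround_fiberP h x v : 0 < h -> lround h v = x <->
  forall i, h * (icoord c x i)%:~R <= lcoord c v 0 i < h * (icoord c x i + 1)%:~R.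
Proof.
move=> h0; split=> [<- i|vx].
  by rewrite icoord_lround ![h * _]mulrC -ler_pdivlMr// -ltr_pdivrMr// floor_itv.
apply: icoord_inj => i; rewrite icoord_lround; apply: floor_def.
by rewrite ler_pdivlMr// ltr_pdivrMr// ![_ * h]mulrC.
Qed.

Definition mesh_points (h : R) (U : set E) : set L := [set x | U (h *: iota x)].

Lemma finite_mesh_points h U rho : 0 < h -> U `<=` beta E rho ->
  finite_set (mesh_points h U).
Proof.
move=> h0 Urho; have [M M0 bM] := coord_le_norm c.
pose B := `|Num.ceil (M * rho / h)|%N.
pose f (k : {ffun 'I_n -> 'I_(B + B).+1}) : L :=
  \sum_i lbasis c i *~ ((k i)%:Z - B%:Z).
apply: (@sub_finite_set _ _ (range f)); last exact: finite_image.
move=> x /Urho xrho; pose k : {ffun 'I_n -> 'I_(B + B).+1} :=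
  [ffun i => inord `|icoord c x i + B|].
exists k => //; rewrite -[RHS](icoordK c); apply: eq_bigr => i _; congr (_ *~ _).
have xB : (`|icoord c x i| <= B)%N.
  have rho0 : 0 <= rho by apply: le_trans xrho.
  have Mrho : 0 <= M * rho / h by rewrite !mulr_ge0 ?invr_ge0 // ltW.
  rewrite -(ler_nat R) /B !natr_absz [X in _ <= X%:~R]ger0_norm; last first.
    by rewrite ceil_ge0 (lt_le_trans _ Mrho)// ltrN10.
  apply: le_trans (ceil_ge _); rewrite ler_pdivlMr//.
  apply: le_trans (_ : M * `|h *: iota x| <= _); last by rewrite ler_pM2l.
  apply: le_trans (bM _ i); rewrite linearZ mxE lcoord_iota normrM gtr0_norm//.
  by rewrite intr_norm mulrC.
rewrite ffunE inordK; last by lia.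
by rewrite gez0_abs ?addrK//; lia.
Qed.

End Tiles.

(** * Volume of the cells *)

Section Volume.
Context (R : realType) (L : zmodType) (E : normedModType R).
Context (iota : {additive L -> E}) (c : lattice_coordinates iota).
Context (vol : {measure set (borel E) -> \bar R}).
Hypothesis vol_lebesgue : lebesgue_measure_on vol.
Local Notation n := (lrank c).
Local Notation lround := (lround c).

Lemma open_borel (U : set E) : open U -> measurable (U : set (borel E)).
Proof. by move=> oU; apply: sub_sigma_algebra. Qed.

Lemma closed_borel (K : set E) : closed K -> measurable (K : set (borel E)).
Proof.
move=> cK; rewrite -[K]setCK; apply: measurableC; apply: open_borel.
exact: closed_openC.
Qed.

Lemma beta_closed rho : closed (beta E rho).
Proof.
apply: (@closed_comp _ _ (fun v : E => `|v|) [set t | t <= rho]) => [v _|].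
  exact: norm_continuous.
exact: closed_le.
Qed.

Lemma beta_compact rho : compact (beta E rho).
Proof.
have [M M0 bM] := coord_le_norm c.
pose S := [set a : 'rV[R]_n |
  forall i, `[- (M * rho), M * rho]%classic (a ord0 i)].
have cS : compact S.
  apply: (@rV_compact _ _ (fun=> `[- (M * rho), M * rho]%classic)) => _.
  exact: segment_compact.
have cI : compact (@of_coord _ _ _ _ c @` S).
  apply: continuous_compact => //; apply: continuous_subspaceT.
  exact: of_coord_continuous.
apply: (subclosed_compact _ cI); first exact: beta_closed.
move=> v vrho; exists (lcoord c v); last by rewrite /of_coord lcoordK.
move=> i; rewrite /= in_itv /= -ler_norml; apply: le_trans (bM _ _) _.
by rewrite ler_pM2l.
Qed.

Lemma vol_lt_pinfty U rho : measurable (U : set (borel E)) -> U `<=` beta E rho ->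
  (vol U < +oo)%E.
Proof.
have [_ vol_compact _] := vol_lebesgue.
move=> mU Urho; apply: (@le_lt_trans _ _ (vol (beta E rho))); last first.
  exact: vol_compact (@beta_compact rho).
apply: le_measure => //; rewrite ?inE//; apply: closed_borel; exact: beta_closed.
Qed.

Lemma measurable_fiber h x : 0 < h ->
  measurable (lround h @^-1` [set x] : set (borel E)).
Proof.
move=> h0; rewrite (_ : _ @^-1` _ = \bigcap_(i in [set: 'I_n])
  ([set v | h * (icoord c x i)%:~R <= lcoord c v 0 i] `&`
   [set v | lcoord c v 0 i < h * (icoord c x i + 1)%:~R])).
  apply: fin_bigcap_measurable => [|i _]; first exact: finite_finset.
  apply: measurableI.
    apply: closed_borel.
    apply: (@closed_comp _ _ (fun v => lcoord c v 0 i)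
      [set t | h * (icoord c x i)%:~R <= t]) => [v _|].
      exact: coord_i_continuous.
    exact: closed_ge.
  apply: open_borel.
  apply: (@open_comp _ _ (fun v => lcoord c v 0 i)
    [set t | t < h * (icoord c x i + 1)%:~R]) => [v _|].
    exact: coord_i_continuous.
  exact: open_lt.
apply/seteqP; split=> v /=.
  by move=> /(lround_fiberP _ _ _ h0) vx i _; apply/andP; exact: vx.
by move=> vx; apply/(lround_fiberP _ _ _ h0) => i; apply/andP; exact: vx.
Qed.

Definition cell_volume (h : R) : \bar R := vol (lround h @^-1` [set 0]).

Lemma vol_fiber h x : 0 < h -> vol (lround h @^-1` [set x]) = cell_volume h.
Proof.
have [vol_shift _ _] := vol_lebesgue.
move=> h0; rewrite lround_fiber// vol_shift//.
exact: measurable_fiber.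
Qed.

Lemma preimage_fset h (X : {fset L}) :
  lround h @^-1` [set` X] = \big[setU/set0]_(x <- X) (lround h @^-1` [set x]).
Proof.
rewrite -bigcup_fset; apply/seteqP; split=> v /= => [vX|[x xX ->//]].
by exists (lround h v).
Qed.

Lemma vol_tiles_fset h (X : {fset L}) : 0 < h ->
  vol (lround h @^-1` [set` X]) = ((#|` X|)%:R%:E * cell_volume h)%E.
Proof.
move=> h0; rewrite preimage_fset measure_fbigsetU.
- rewrite (eq_bigr (fun=> cell_volume h)) => [|x _]; last exact: vol_fiber.
  rewrite big_const_seq count_predT.
  by rewrite mule_natl -Monoid.iteropE.
- by move=> x _; exact: measurable_fiber.
- by move=> x y _ _ [v [<- <-]].
Qed.

Lemma measurable_tiles h X : 0 < h -> finite_set X ->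
  measurable (lround h @^-1` X : set (borel E)).
Proof.
move=> h0 fX; rewrite -(fset_setK fX) preimage_fset.
by apply: bigsetU_measurable => x _; exact: measurable_fiber.
Qed.

Lemma vol_tiles h X : 0 < h -> finite_set X ->
  vol (lround h @^-1` X) = ((#|` fset_set X|)%:R%:E * cell_volume h)%E.
Proof. by move=> h0 fX; rewrite -{1}(fset_setK fX) vol_tiles_fset. Qed.

Lemma cell_volume_fin h : 0 < h -> cell_volume h \is a fin_num.
Proof.
move=> h0; rewrite ge0_fin_numE//.
apply: (@vol_lt_pinfty _ (h * basis_size c)); first exact: measurable_fiber.
move=> v v0; have := lround_near c v h0.
by rewrite v0 raddf0 scaler0 sub0r normrN.
Qed.

(** A cell of mesh [h] is tiled by [b ^ n] cells of mesh [h / b], all of the same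
    volume by translation invariance; this is how dilations by rational factors
    act on the volumes of cells. *)
Lemma cell_volume_div h (b : nat) : 0 < h -> (0 < b)%N ->
  cell_volume h = ((b ^ n)%:R%:E * cell_volume (h / b%:R))%E.
Proof.
move=> h0 b0; have hb0 : 0 < h / b%:R by rewrite divr_gt0 ?ltr0n.
pose f (k : {ffun 'I_n -> 'I_b}) : L := \sum_i lbasis c i *~ (k i)%:Z.
have icoord_f k i : icoord c (f k) i = (k i)%:Z.
  pose a := [ffun j => (k j)%:Z].
  have -> : f k = \sum_j lbasis c j *~ a j.
    by apply: eq_bigr => j _; rewrite ffunE.
  by rewrite icoord_sum ffunE.
have f_inj : injective f.
  move=> k l kl; apply/ffunP => i; apply/val_inj.
  by have := icoord_f k i; rewrite kl icoord_f => -[].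
pose X := [fset f k | k in {ffun 'I_n -> 'I_b}]%fset.
have -> : (b ^ n)%N = #|` X|.
  by rewrite card_imfset//= -cardT card_ffun !card_ord.
rewrite -vol_tiles_fset// /cell_volume; congr (vol _).
have zero0 i : icoord c 0 i = 0.
  pose a : {ffun 'I_n -> int} := [ffun=> 0].
  have -> : 0 = \sum_j lbasis c j *~ a j :> L.
    by rewrite big1// => j _; rewrite ffunE mulr0z.
  by rewrite icoord_sum ffunE.
have b_gt0 : 0 < (b%:R : R) by rewrite ltr0n.
apply/seteqP; split=> v /=.
  move=> /(lround_fiberP _ _ _ h0) vh.
  have z_bound i : 0 <= icoord c (lround (h / b%:R) v) i < b%:Z.
    have /andP[] := vh i; rewrite zero0 mulr0 mulr1 icoord_lround => lo hi.
    rewrite floor_ge0 divr_ge0 ?(ltW hb0)//= floor_lt_int.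
    by rewrite invfM invrK mulrA gtr_pMl ?ltr_pdivrMr ?mul1r.
  have z_lt i : (`|icoord c (lround (h / b%:R) v) i| < b)%N.
    by have := z_bound i; lia.
  apply/imfsetP; exists [ffun i => Ordinal (z_lt i)] => //.
  apply: (icoord_inj (c := c)) => i; rewrite icoord_f ffunE /= gez0_abs//.
  by case/andP: (z_bound i).
move=> /imfsetP[/= k _ vk]; apply/(lround_fiberP _ _ _ h0) => i.
have /(lround_fiberP _ _ _ hb0)/(_ i) := vk; rewrite icoord_f zero0.
move=> /andP[lo hi]; rewrite mulr0 mulr1; apply/andP; split.
  by apply: le_trans lo; rewrite mulr_ge0// ltW.
apply: lt_le_trans hi _; rewrite -mulrA ger_pMr// ler_pdivrMl// mulr1.
by rewrite -[b%:R]/(b%:Z%:~R) ler_int; have := ltn_ord (k i); lia.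
Qed.

End Volume.

(** * Counting lattice points by volume *)

Section Counting.
Context (R : realType) (L : zmodType) (E : normedModType R).
Context (iota : {additive L -> E}) (c : lattice_coordinates iota).
Context (vol : {measure set (borel E) -> \bar R}).
Hypothesis vol_lebesgue : lebesgue_measure_on vol.
Local Notation n := (lrank c).

Definition lattice_count (h : R) (U : set E) : nat :=
  #|` fset_set (mesh_points iota h U)|.

Definition cell_size (h : R) : R := fine (cell_volume c vol h).

Lemma cell_sizeE h : 0 < h -> cell_volume c vol h = (cell_size h)%:E.
Proof. by move=> h0; rewrite fineK//; exact: cell_volume_fin. Qed.

Lemma cell_size_ge0 h : 0 <= cell_size h.
Proof. by rewrite fine_ge0. Qed.

Definition tiles (h : R) (U : set E) : set E :=
  lround c h @^-1` mesh_points iota h U.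

Lemma vol_tiles_count h U rho : 0 < h -> U `<=` beta E rho ->
  vol (tiles h U) = ((lattice_count h U)%:R * cell_size h)%:E.
Proof.
move=> h0 Urho; rewrite vol_tiles//; last exact: finite_mesh_points Urho.
by rewrite cell_sizeE.
Qed.

Lemma measurable_tiles_beta h U rho : 0 < h -> U `<=` beta E rho ->
  measurable (tiles h U : set (borel E)).
Proof.
by move=> h0 Urho; apply: measurable_tiles => //; exact: finite_mesh_points Urho.
Qed.

Lemma cvg_mesh_round (h : nat -> R) v : (forall k, 0 < h k) ->
  h k @[k --> \oo] --> 0 -> h k *: iota (lround c (h k) v) @[k --> \oo] --> v.
Proof.
move=> h0 hcvg.
rewrite -[X in _ --> X]addr0.
have -> : (fun k => h k *: iota (lround c (h k) v)) =
    (fun k => v + (h k *: iota (lround c (h k) v) - v)).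
  by apply/funext => k; rewrite addrC subrK.
apply: cvgD; first exact: cvg_cst.
apply/norm_cvg0P.
apply: (@squeeze_cvgr _ _ _ _ (fun=> 0) (fun k => h k * basis_size c)).
- by near=> k; rewrite normr_ge0 lround_near.
- exact: cvg_cst.
- by rewrite -[X in _ --> X](mul0r (basis_size c)); exact: cvgMr_tmp.
Unshelve. all: by end_near. Qed.

(** As the mesh tends to zero, the corner of the cell of a point of [U] is
    eventually in [U], so [U] is contained in the inferior limit of the unions
    of cells with corner in [U]; continuity from below concludes. *)
Lemma count_open_lower (U : set E) rho (h : nat -> R) (a : R) :
  (forall k, 0 < h k) -> h k @[k --> \oo] --> 0 -> open U -> U `<=` beta E rho ->
  (a%:E < vol U)%E ->
  \forall k \near \oo, a < (lattice_count (h k) U)%:R * cell_size (h k).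
Proof.
move=> h0 hcvg oU Urho aU.
have mT k : measurable (tiles (h k) U : set (borel E)).
  exact: measurable_tiles_beta Urho.
have mU : measurable (U : set (borel E)) by exact: open_borel.
pose B N := U `&` \bigcap_(k in [set k | (N <= k)%N]) tiles (h k) U.
have mB N : measurable (B N : set (borel E)).
  apply: measurableI => //.
  by apply: bigcap_measurable => [|k _]; [exists N => /=|exact: mT].
have UB : \bigcup_N B N = U.
  apply/seteqP; split=> [v [N _ []]//|v Uv].
  have := cvg_mesh_round (v := v) h0 hcvg.
  move=> /(_ U (open_nbhs_nbhs (conj oU Uv))) [N _ NU].
  by exists N => //; split=> // k Nk; exact: NU.
have ndB : nondecreasing_seq B.
  move=> N M NM; apply/subsetPset => v [Uv vN]; split=> // k Mk.
  by apply: vN; exact: leq_trans Mk.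
have : vol (B N) @[N --> \oo] --> vol U.
  rewrite -[X in _ --> vol X]UB; apply: nondecreasing_cvg_mu => //.
  by rewrite UB.
move=> /(_ [set y | (a%:E < y)%E]) volB.
have : nbhs (vol U) [set y | (a%:E < y)%E].
  by apply: open_nbhs_nbhs; split=> //; exact: open_ereal_gt_ereal.
move=> /volB[N _ NB]; exists N => // k Nk; rewrite -lte_fin.
rewrite -(vol_tiles_count (h0 k) Urho).
apply: lt_le_trans (NB k Nk) _; apply: le_measure; rewrite ?inE//.
by move=> v [_]; apply => /=.
Qed.

(** Dually, a point that infinitely often lies in a cell with corner in [K] is
    a limit of points of [K], and continuity from above applies because [K] is
    bounded. *)
Lemma count_closed_upper (K : set E) rho (h : nat -> R) (a : R) :
  (forall k, 0 < h k <= 1) -> h k @[k --> \oo] --> 0 -> closed K ->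
  K `<=` beta E rho -> (vol K < a%:E)%E ->
  \forall k \near \oo, (lattice_count (h k) K)%:R * cell_size (h k) < a.
Proof.
move=> h01 hcvg cK Krho Ka.
have h0 k : 0 < h k by case/andP: (h01 k).
have mT k : measurable (tiles (h k) K : set (borel E)).
  exact: measurable_tiles_beta Krho.
have mK : measurable (K : set (borel E)) by exact: closed_borel.
have tilesK k : tiles (h k) K `<=` beta E (rho + basis_size c).
  move=> v /Krho; rewrite /beta /= => vrho.
  rewrite -[v](subKr (h k *: iota (lround c (h k) v))).
  apply: le_trans (ler_normB _ _) _; rewrite lerD//.
  apply: le_trans (lround_near c v (h0 k)) _.
  by rewrite ler_piMl ?basis_size_ge0//; case/andP: (h01 k).
have limK : lim_sup_set (fun k => tiles (h k) K) `<=` K.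
  move=> v vT; apply: cK => B vB.
  have := cvg_mesh_round (v := v) h0 hcvg; move=> /(_ B vB)[N _ NB].
  have [k /= Nk vk] := vT N I.
  by exists (h k *: iota (lround c (h k) v)); split=> //; exact: NB.
have mC N : measurable
    (\bigcup_(k in [set k | (N <= k)%N]) tiles (h k) K : set (borel E)).
  by apply: bigcup_measurable => k _; exact: mT.
have : vol (\bigcup_(k in [set k | (N <= k)%N]) tiles (h k) K) @[N --> \oo] -->
    vol (lim_sup_set (fun k => tiles (h k) K)).
  apply: (lim_sup_set_cvg vol (fun k => tiles (h k) K)) => //.
  apply: (vol_lt_pinfty c vol_lebesgue (rho := rho + basis_size c)) => //.
  by move=> v [k _]; exact: tilesK.
move=> /(_ [set y | (y < a%:E)%E]) volC.
have : nbhs (vol (lim_sup_set (fun k => tiles (h k) K))) [set y | (y < a%:E)%E].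
  apply: open_nbhs_nbhs; split; first exact: open_ereal_lt_ereal.
  apply: le_lt_trans Ka; apply: le_measure; rewrite ?inE//.
  apply: bigcap_measurable => [|N _]; [by exists 0%N|exact: mC].
move=> /volC[N _ NC]; exists N => // k Nk; rewrite -lte_fin.
rewrite -(vol_tiles_count (h0 k) Krho).
apply: le_lt_trans (NC k Nk); apply: le_measure; rewrite ?inE//.
by move=> v vk; exists k => /=.
Qed.

End Counting.

(** * Density of the lattice points of an open cone *)

Lemma limn_einf_ge (R : realType) (u : (\bar R)^nat) (a : \bar R) :
  (\forall k \near \oo, (a <= u k)%E) -> (a <= limn_einf u)%E.
Proof.
move=> [N _ Nu]; rewrite limn_einf_lim; apply: lime_ge; first exact: is_cvg_einfs.
exists N => // k Nk /=; apply: le_ereal_inf_tmp => _ [j /= kj <-].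
by apply: Nu; exact: leq_trans kj.
Qed.

Section Density.
Context (R : realType) (L : zmodType) (E : normedModType R).
Context (iota : {additive L -> E}) (c : lattice_coordinates iota).
Context (vol : {measure set (borel E) -> \bar R}).
Hypothesis vol_lebesgue : lebesgue_measure_on vol.
Local Notation cell_size := (cell_size c vol).

Lemma cell_size_dilate (h : R) (k : nat) : 0 < h -> (0 < k)%N ->
  k%:R ^+ lrank c * cell_size (k.+1%:R / k%:R * h) =
  k.+1%:R ^+ lrank c * cell_size h.
Proof.
move=> h0 k0.
have size_div t (b : nat) : 0 < t -> (0 < b)%N ->
    cell_size t = b%:R ^+ lrank c * cell_size (t / b%:R).
  move=> t0 b0; have tb0 : 0 < t / b%:R by rewrite divr_gt0 ?ltr0n.
  have := cell_volume_div c vol_lebesgue t0 b0.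
  by rewrite !cell_sizeE// -EFinM natrX => -[].
have kR0 : 0 < (k%:R : R) by rewrite ltr0n.
rewrite (size_div _ k.+1) ?mulr_gt0 ?invr_gt0 ?ltr0n// mulrCA; congr (_ * _).
rewrite (size_div h k)//; congr (_ * cell_size _).
by rewrite -mulrA mulrC !mulrA mulVf ?mul1r 1?mulrC// pnatr_eq0.
Qed.

(** Points of the lattice in the ball of radius [N] are points of mesh [1 / N] in
    the unit ball. The numerator is bounded below on the slightly larger open
    set [U] of radius [q = (k + 1) / k], with mesh [q / N], which gives points
    of the cone in the same ball; [U] is open and contains the closed piece
    whose volume is wanted. The cost is the factor [x k = k / (k + 1)], which is raised to the
    power [n] by the change of mesh, appears once more in each of the two
    approximations of volumes, and tends to one. *)
Theorem density_open_cone (D : set E) (Z : set L) :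
  open D -> (forall v t, 0 < t -> D (t *: v) -> D v) ->
  iota @^-1` D `<=` Z ->
  (vol (D `&` beta E 1) / vol (beta E 1) <= lower_density iota Z)%E.
Proof.
move=> oD coneD DZ.
have mD : measurable (D : set (borel E)) by exact: open_borel.
have mbeta : measurable (beta E 1 : set (borel E)).
  by apply: closed_borel; exact: beta_closed.
have mDbeta : measurable (D `&` beta E 1 : set (borel E)) by exact: measurableI.
have vol_fin U rho : measurable (U : set (borel E)) -> U `<=` beta E rho ->
    vol U \is a fin_num.
  move=> mU Urho; rewrite ge0_fin_numE//.
  exact: (vol_lt_pinfty c vol_lebesgue mU Urho).
have := vol_fin _ 1 mDbeta (@subIsetr _ _ _).
have := vol_fin _ 1 mbeta (@subset_refl _ _).
set V1 := vol (_ `&` _); set V2 := vol _ => fV2 fV1.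
pose v1 := fine V1; pose v2 := fine V2.
have V1E : V1 = v1%:E by rewrite fineK.
have V2E : V2 = v2%:E by rewrite fineK.
have v1_ge0 : 0 <= v1 by rewrite fine_ge0// measure_ge0.
have v12 : v1 <= v2.
  rewrite -lee_fin -V1E -V2E; apply: le_measure; rewrite ?inE//.
pose z N := #|` fset_set (Z `&` iota @^-1` beta E N%:R)|.
pose b N := #|` fset_set (iota @^-1` beta E N%:R)|.
have -> : lower_density iota Z =
    limn_einf (fun N => ((z N)%:R / (b N)%:R : R)%:E).
  by [].
rewrite V1E V2E; move: v1_ge0; rewrite le_eqVlt => /predU1P[<-|v1_gt0].
  rewrite mul0e; apply: limn_einf_ge.
  by apply: nearW => N; rewrite lee_fin divr_ge0.
have v2_gt0 : 0 < v2 by apply: lt_le_trans v12.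
rewrite inver gt_eqF// -EFinM.
pose x k : R := k%:R / k.+1%:R.
have xE k : x k = 1 - harmonic k.
  by rewrite /x /harmonic /= -natr1; field; rewrite natr1 pnatr_eq0.
have x_cvg : (v1 / v2 * x k ^+ (lrank c).+2)%:E @[k --> \oo] --> (v1 / v2)%:E.
  have x_cvg1 : x k @[k --> \oo] --> (1 : R).
    rewrite (_ : x = fun k => 1 - harmonic k); last exact/funext.
    have := cvgB (cvg_cst (1 : R)) (@cvg_harmonic R).
    by rewrite subr0; apply.
  have : v1 / v2 * x k ^+ (lrank c).+2 @[k --> \oo] -->
      v1 / v2 * 1 ^+ (lrank c).+2.
    apply: (@cvgMl_tmp _ _ \oo).
    exact: (cvg_comp _ _ x_cvg1 (exprn_continuous (x := 1))).
  by rewrite expr1n mulr1 => x_cvg; apply: cvg_EFin => //; exact: nearW.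
apply: (cvge_to_le x_cvg).
(* k = 0 is excluded because q divides by k *)
exists 1%N => // k /= k0; apply: limn_einf_ge.
have kR0 : 0 < (k%:R : R) by rewrite ltr0n.
have xk0 : 0 < x k by rewrite divr_gt0 ?ltr0n.
have xk1 : x k < 1 by rewrite ltr_pdivrMr// mul1r ltr_nat.
pose q : R := k.+1%:R / k%:R.
have qE : q = (x k)^-1 by rewrite /q invf_div.
have q1 : 1 < q by rewrite qE invf_gt1.
pose U := D `&` [set v : E | `|v| < q].
have U_beta : U `<=` beta E q by move=> v [_ /ltW].
have oU : open U.
  apply: openI => //.
  apply: (@open_comp _ _ (fun v : E => `|v|) [set t | t < q]) => [v _|].
    exact: norm_continuous.
  exact: open_lt.
have lowU : ((v1 * x k)%:E < vol U)%E.
  apply: (@lt_le_trans _ _ V1).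
    by rewrite V1E lte_fin gtr_pMr.
  apply: le_measure; rewrite ?inE//; first exact: open_borel.
  by move=> v [Dv vb]; split=> //; exact: le_lt_trans q1.
have upB : (vol (beta E 1) < (v2 / x k)%:E)%E.
  by rewrite -/V2 V2E lte_fin ltr_pdivlMr// gtr_pMr.
have hcvg : harmonic N @[N --> \oo] --> (0 : R) by exact: cvg_harmonic.
have qhcvg : q * harmonic N @[N --> \oo] --> (0 : R).
  by rewrite -[X in _ --> X](mulr0 q); exact: cvgMl_tmp.
have qh0 N : 0 < q * harmonic N.
  by rewrite mulr_gt0 ?harmonic_gt0// (lt_trans _ q1).
have h01 N : 0 < (harmonic N : R) <= 1.
  by rewrite harmonic_gt0 /= invf_le1 ?ler1n.
apply: near_inftyS.
have nlow := count_open_lower c vol_lebesgue qh0 qhcvg oU U_beta lowU.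
have nup := count_closed_upper c vol_lebesgue h01 hcvg
  (@beta_closed _ _ _) (@subset_refl _ _) upB.
near=> N.
have : v1 * x k <
    (lattice_count iota (q * harmonic N) U)%:R * cell_size (q * harmonic N).
  by near: N; exact: nlow.
have : (lattice_count iota (harmonic N) (beta E 1))%:R *
    cell_size (harmonic N) < v2 / x k.
  by near: N; exact: nup.
have fbeta : finite_set (iota @^-1` beta E N.+1%:R).
  have := @finite_mesh_points _ _ _ _ c 1 _ _ ltr01 (@subset_refl _ (beta E N.+1%:R)).
  by rewrite /mesh_points; under eq_set do rewrite scale1r.
have -> : lattice_count iota (harmonic N) (beta E 1) = b N.+1.
  rewrite /lattice_count /b; congr (#|` fset_set _|); apply/seteqP.
  by split=> y; rewrite /mesh_points /beta /= normrZ gtr0_norm ?invr_gt0//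
    ler_pdivrMl// mulr1.
have count_le : (lattice_count iota (q * harmonic N) U <= z N.+1)%N.
  apply: fsubset_leq_card; rewrite -fset_set_sub.
  - move=> y [Dy /= yq]; split; first by apply: DZ; exact: coneD Dy.
    move: yq; rewrite normrZ (gtr0_norm (qh0 N)) -mulrA gtr_pMr ?(lt_trans _ q1)//.
    by rewrite ltr_pdivrMl// mulr1 => /ltW.
  - by apply: finite_mesh_points U_beta.
  - by apply: sub_finite_set fbeta; exact: subIsetr.
have h0 : 0 < (harmonic N : R) by case/andP: (h01 N).
have := cell_size_dilate h0 k0; rewrite -/q.
set s' := cell_size (q * _); set s := cell_size _ => sizeE.
have {}sizeE : x k ^+ lrank c * s' = s.
  apply: (@mulfI _ (k.+1%:R ^+ lrank c)); first by rewrite expf_neq0// pnatr_eq0.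
  by rewrite -sizeE /x expr_div_n mulrA mulrCA divff ?mulr1// expf_neq0// pnatr_eq0.
have s'_ge0 : 0 <= s' by exact: cell_size_ge0.
move=> up low.
have {}low : v1 * x k < (z N.+1)%:R * s'.
  by apply: lt_le_trans low _; rewrite ler_wpM2r// ler_nat.
have s'_gt0 : 0 < s'.
  rewrite lt_def s'_ge0 andbT; apply: contraTneq low => ->.
  by rewrite mulr0 -leNgt mulr_ge0 ?ltW.
have s_gt0 : 0 < s by rewrite -sizeE mulr_gt0// exprn_gt0.
have b_gt0 : 0 < ((b N.+1)%:R : R).
  rewrite ltr0n cardfs_gt0; apply/fset0Pn; exists 0.
  by rewrite in_fset_set// inE /= raddf0 /beta /= normr0.
rewrite lee_fin ler_pdivlMr// -(ler_pM2r s_gt0).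
rewrite ltr_pdivlMr// in up.
have v1x : v1 * x k ^+ (lrank c).+1 <= (z N.+1)%:R * s.
  have -> : v1 * x k ^+ (lrank c).+1 = x k ^+ lrank c * (v1 * x k).
    by rewrite exprSr mulrCA.
  by rewrite -sizeE [leRHS]mulrCA ler_pM2l ?exprn_gt0// ltW.
apply: le_trans (_ : v1 * x k ^+ (lrank c).+1 *
    ((b N.+1)%:R * s * x k / v2) <= _).
  rewrite le_eqVlt; apply/orP; left; apply/eqP; rewrite !exprS; field.
  by rewrite gt_eqF.
apply: le_trans (_ : v1 * x k ^+ (lrank c).+1 * 1 <= _); last by rewrite mulr1.
rewrite ler_wpM2l ?mulr_ge0 ?exprn_ge0 ?ltW//.
by rewrite ltr_pdivrMr// mul1r.
Unshelve. all: by end_near. Qed.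

End Density.

(** * The theorem *)

Theorem mainTheorem1 (R : realType) (L : zmodType) (E : normedModType R)
    (iota : {additive L -> E}) (d : nat)
    (m : cosets L d -> nat) (r : cosets L d -> L) (T : L -> L)
    (vol : {measure set (borel E) -> \bar R}) :
  free_of_finite_rank L ->
  is_real_extension iota ->
  (1 < d)%N ->
  collatz_data m r ->
  collatz_mapping m r T ->
  relatively_prime_type m ->
  acute (shift_vectors iota r) ->
  lebesgue_measure_on vol ->
  (forall x : L, tame_cone iota m r (iota x) -> divergent T x) /\
  (vol (tame_cone iota m r `&` beta E 1) / vol (beta E 1)
     <= lower_density iota (Div T))%E.
Proof.
move=> freeL ext d_gt1 data collatzT coprime_m _ vol_lebesgue.
have [c] := lattice_coordinates_exist freeL ext.
have divT x : tame_cone iota m r (iota x) -> divergent T x.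
  exact: (tame_divergent c d_gt1 data coprime_m collatzT).
split=> //; apply: (density_open_cone c vol_lebesgue) => [|v t t0 Dtv Wv|x].
- by apply: closed_openC; exact: (wild_cone_closed c d_gt1 data coprime_m).
- by apply: Dtv; apply: (wild_coneZ c (ltW t0)).
- exact: divT.
Qed.
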